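(* Let $p$ be a prime, let $G$ be a finite group and let $B$ be a $p$-block of $G$ with defect group $D$. Then the $B$-classes of $D$ are exactly the $G$-classes of $D$ under conjugation; that is, for $x,y\in D$ we have $\chi(x)=\chi(y)$ for every $\chi\in\mathrm{Irr}(B)$ if and only if $x$ and $y$ are conjugate in $G$.
   Context: $\mathrm{Irr}(B)$ is the set of irreducible ordinary (complex) characters in the block $B$. Two elements $x,y\in D$ are in the same $B$-class if $\chi(x)=\chi(y)$ for every $\chi\in\mathrm{Irr}(B)$. The $G$-classes of $D$ are the equivalence classes of elements of $D$ under the relation of being conjugate in $G$. *)

(* Defs.v *)
(* Ordinary characters take values in the algebraic complex numbers [algC], as
   everywhere in mathcomp.character. *)
From mathcomp Require Import all_boot all_order all_fingroup all_algebra.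
From mathcomp Require Import all_solvable all_field all_character.

Set Implicit Arguments.
Unset Strict Implicit.
Unset Printing Implicit Defensive.

Import Order.TTheory GroupScope GRing.Theory Num.Theory.
Local Open Scope ring_scope.

(* Blocks are set up as in Navarro, "Characters and Blocks of Finite Groups",
   chapters 3 and 4: Aint is the ring of algebraic integers, M is a maximal
   ideal of Aint containing p, and "^*" is reduction modulo M, onto the field
   Aint / M of characteristic p. *)

Definition Aint_ideal (I : {pred algC}) : Prop :=
  [/\ {subset I <= Aint}, zmod_closed I
    & {in Aint & I, forall a u, a * u \in I}].

Definition Aint_maximal_ideal (M : {pred algC}) : Prop :=
  [/\ Aint_ideal M, 1 \notin M
    & forall J : {pred algC}, Aint_ideal J -> {subset M <= J} ->
        1 \notin J -> {subset J <= M}].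

(* ^* extends to the localization of Aint at M by (r / s)^* = r^* / s^*.  This
   says that z belongs to that localization and that z^* is nonzero. *)
Definition nonzero_residue (M : {pred algC}) (z : algC) : Prop :=
  exists r s : algC,
    [/\ r \in Aint, s \in Aint, r \notin M, s \notin M & z = r / s].

(* Equality of the characters lambda_i = ('omega_i)^* of the center of the
   modular group algebra; 'K_k is the k-th conjugacy class sum. *)
Definition same_block (M : {pred algC}) (gT : finGroupType) (G : {group gT})
    (i j : Iirr G) : bool :=
  [forall k : 'I_#|classes G|, 'omega_i['K_k] - 'omega_j['K_k] \in M].

(* A block is represented by the set of indices of its ordinary irreducible
   characters: 'chi_i \in Irr(B) is i \in B. *)
Definition is_block (M : {pred algC}) (gT : finGroupType) (G : {group gT})
    (B : {set Iirr G}) : Prop :=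
  exists i : Iirr G, B = [set j | same_block M i j].

(* Coefficient at x of the sum over B of the primitive central idempotents of
   the complex group algebra; its image under ^* is the coefficient at x of the
   block idempotent. *)
Definition block_idem_coef (gT : finGroupType) (G : {group gT})
    (B : {set Iirr G}) (x : gT) : algC :=
  #|G|%:R^-1 * \sum_(i in B) 'chi_i 1%g * 'chi_i x^-1%g.

(* The k-th conjugacy class of G is a defect class of B: it has a nonzero
   coefficient in the block idempotent, and the central character lambda_B does
   not vanish on its class sum. *)
Definition defect_class (M : {pred algC}) (gT : finGroupType) (G : {group gT})
    (B : {set Iirr G}) (k : 'I_#|classes G|) : Prop :=
  {in enum_val k, forall x, nonzero_residue M (block_idem_coef B x)} /\
  {in B, forall i, 'omega_i['K_k] \notin M}.

(* Defect groups of B are the defect groups of its defect classes, i.e. the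
   Sylow p-subgroups of centralizers of their elements. *)
Definition defect_group (p : nat) (M : {pred algC}) (gT : finGroupType)
    (G : {group gT}) (B : {set Iirr G}) (D : {group gT}) : Prop :=
  exists (k : 'I_#|classes G|) (x : gT),
    [/\ defect_class M B k, x \in enum_val k & p.-Sylow('C_G[x]) D].

(* Main.v *)
(* Let R be the localization of Aint at M and e_B the coefficient function of
   the idempotent of B.

   - e_B has values in R: a product of polynomials in the class sums takes
     residue 1 on B and 0 off B, and an element of the centre of RG whose
     central character values have residues 0 and 1 lifts to an idempotent of
     RG, because every element of the maximal ideal of R has a power in pR.

   - If the p-parts of a and b are not conjugate, the sum over B of
     chi(a) chi(b^-1) is 0.  It is the trace of m |-> a m b^-1 on the module
     e_B RG.  Every orbit of this permutation T of G has length divisible by p,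
     so there is a diagonal matrix D of p-th roots of unity with T D = zeta D T.
     Modulo M the compression of D to e_B RG is the identity, hence it is
     invertible; it conjugates T into zeta T, and the trace is 0.

   - If x in D, some chi in B does not vanish at x.  Otherwise the sum over
     v in x^G of e_B(v^-1 x g) is 0, where g lies in a defect class and is
     centralized by D; modulo M only v in C = C_G(x) contribute.  The restriction
     of e_B to C is idempotent modulo M, hence lifts to an idempotent of RC, and
     the vanishing theorem in C leaves only the term v = x, which is e_B(g),
     although e_B(g) is nonzero modulo M.

   If chi(x) = chi(y) for all chi in B and x, y are not conjugate, the second
   item makes the sum over B of |chi(x)|^2 vanish, against the third. *)
Require Import Defs.
From mathcomp Require Import all_boot all_order all_fingroup all_algebra.
From mathcomp Require Import all_solvable all_field all_character.
From HB Require Import structures.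
From mathcomp Require Import ring.
From mathcomp.classical Require Import boolp.
Import Order.TTheory GroupScope GRing.Theory Num.Theory.
Local Open Scope ring_scope.

Set Implicit Arguments.
Unset Strict Implicit.
Unset Printing Implicit Defensive.

(** * Localization of the algebraic integers at a maximal ideal *)

Section MaximalIdeal.

Variables (M : {pred algC}) (maxM : Aint_maximal_ideal M).

Lemma maxideal_sub : {subset M <= Aint}.
Proof. by case: maxM => -[]. Qed.

Lemma maxideal_zmod : zmod_closed M.
Proof. by case: maxM => -[]. Qed.

Lemma maxidealMl a u : a \in Aint -> u \in M -> a * u \in M.
Proof. by case: maxM => -[_ _ MM] _ _; apply: MM. Qed.

Lemma maxidealN1 : 1 \notin M.
Proof. by case: maxM. Qed.

Lemma maxideal0 : 0 \in M.
Proof. by case: maxideal_zmod. Qed.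

Lemma maxidealB u v : u \in M -> v \in M -> u - v \in M.
Proof. by case: maxideal_zmod => _; apply. Qed.

Lemma maxidealD u v : u \in M -> v \in M -> u + v \in M.
Proof.
by move=> Mu Mv; rewrite -[v]opprK maxidealB // -[- v]sub0r maxidealB ?maxideal0.
Qed.

Lemma maxideal_sum I (r : seq I) (P : pred I) (F : I -> algC) :
  (forall i, P i -> F i \in M) -> \sum_(i <- r | P i) F i \in M.
Proof.
by move=> MF; elim/big_ind: _ => //; [apply: maxideal0 | apply: maxidealD].
Qed.

(** If [a] had no inverse modulo [M], the ideal [J] of all [u + a * c] would be proper, hence inside
    [M] by maximality, although it contains [a]. *)
Lemma maxideal_inv a :
  a \in Aint -> a \notin M -> exists2 b, b \in Aint & 1 - a * b \in M.
Proof.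
move=> Aa; apply: contraNP => noinv.
pose J : {pred algC} :=
  fun z => `[< exists u c, [/\ u \in M, c \in Aint & z = u + a * c] >].
have JP z : reflect (exists u c, [/\ u \in M, c \in Aint & z = u + a * c])
                    (z \in J) by apply: asboolP.
case: maxM => _ _ /(_ J) sJM; apply: sJM.
- split.
  + move=> z /JP[u [c [Mu Ac ->]]].
    by rewrite rpredD ?rpredM // maxideal_sub.
  + split.
      by apply/JP; exists 0, 0; rewrite maxideal0 rpred0 mulr0 addr0.
    move=> _ _ /JP[u [c [Mu Ac ->]]] /JP[v [d [Mv Ad ->]]].
    apply/JP; exists (u - v), (c - d); rewrite maxidealB ?rpredB //; split=> //.
    by rewrite mulrBr opprD addrACA.
  + move=> z _ Az /JP[u [c [Mu Ac ->]]]; apply/JP; exists (z * u), (z * c).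
    by split; rewrite ?maxidealMl ?rpredM // mulrDr mulrCA.
- by move=> u Mu; apply/JP; exists u, 0; rewrite Mu rpred0 mulr0 addr0.
- apply/JP=> -[u [c [Mu Ac D1]]]; apply: noinv; exists c => //.
  by rewrite D1 addrK.
- by apply/JP; exists 0, 1; rewrite maxideal0 rpred1 mulr1 add0r.
Qed.

Lemma maxideal_prime a b :
  a \in Aint -> b \in Aint -> a * b \in M -> (a \in M) || (b \in M).
Proof.
move=> Aa Ab Mab; case: (boolP (a \in M)) => //= /(maxideal_inv Aa)[c Ac Mc].
rewrite (_ : b = b * (1 - a * c) + c * (a * b)).
  by apply: maxidealD; apply: maxidealMl.
by ring.
Qed.

Lemma maxidealX a n : a \in Aint -> a ^+ n \in M -> a \in M.
Proof.
move=> Aa; elim: n => [|n IHn]; first by rewrite expr0 (negPf maxidealN1).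
by rewrite exprS => /(maxideal_prime Aa (rpredX _ Aa))/orP[].
Qed.

End MaximalIdeal.

(** The maximality proof is an argument so that the closure instances of [loc maxM] and
    [locmax maxM] can be inferred from the term. *)
Definition loc (M : {pred algC}) of Aint_maximal_ideal M : {pred algC} :=
  fun z => `[< exists r s, [/\ r \in Aint, s \in Aint, s \notin M & z = r / s] >].

Definition locmax (M : {pred algC}) of Aint_maximal_ideal M : {pred algC} :=
  fun z => `[< exists r s, [/\ r \in M, s \in Aint, s \notin M & z = r / s] >].

Section Localization.

Variables (M : {pred algC}) (maxM : Aint_maximal_ideal M).
Local Notation R := (loc maxM).
Local Notation m := (locmax maxM).

Lemma locP z :
  reflect (exists r s, [/\ r \in Aint, s \in Aint, s \notin M & z = r / s])
          (z \in R).
Proof. exact: asboolP. Qed.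

Lemma locmaxP z :
  reflect (exists r s, [/\ r \in M, s \in Aint, s \notin M & z = r / s])
          (z \in m).
Proof. exact: asboolP. Qed.

Lemma maxideal_neq0 s : s \notin M -> s != 0.
Proof. by apply: contraNneq => ->; apply: (maxideal0 maxM). Qed.

Lemma maxideal_notM s t :
  s \in Aint -> t \in Aint -> s \notin M -> t \notin M -> s * t \notin M.
Proof.
move=> As At nMs nMt; apply/negP=> /(maxideal_prime maxM As At).
by rewrite (negPf nMs) (negPf nMt).
Qed.

Lemma loc_subring : subring_closed R.
Proof.
split.
- by apply/locP; exists 1, 1; rewrite !rpred1 divr1 maxidealN1.
- move=> _ _ /locP[r [s [Ar As Ms ->]]] /locP[r' [s' [Ar' As' Ms' ->]]].
  apply/locP; exists (r * s' - r' * s), (s * s').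
  split; rewrite ?rpredB ?rpredM ?maxideal_notM //.
  by rewrite -mulNr addf_div ?maxideal_neq0 // mulNr.
- move=> _ _ /locP[r [s [Ar As Ms ->]]] /locP[r' [s' [Ar' As' Ms' ->]]].
  apply/locP; exists (r * r'), (s * s').
  by split; rewrite ?rpredB ?rpredM ?maxideal_notM // mulf_div.
Qed.

Lemma locmax_zmod : zmod_closed m.
Proof.
split.
  apply/locmaxP; exists 0, 1.
  by rewrite (maxideal0 maxM) rpred1 mul0r maxidealN1.
move=> _ _ /locmaxP[r [s [Ar As Ms ->]]] /locmaxP[r' [s' [Ar' As' Ms' ->]]].
apply/locmaxP; exists (s' * r - s * r'), (s * s').
split; try by rewrite ?rpredM ?maxideal_notM.
  by apply: (maxidealB maxM); apply: (maxidealMl maxM).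
by rewrite -mulNr addf_div ?maxideal_neq0 // mulNr [s' * r]mulrC [s * r']mulrC.
Qed.

Lemma locmaxMl z w : z \in R -> w \in m -> z * w \in m.
Proof.
move=> /locP[r [s [Ar As Ms ->]]] /locmaxP[r' [s' [Ar' As' Ms' ->]]].
apply/locmaxP; exists (r * r'), (s * s').
split; rewrite ?mulf_div ?maxideal_notM ?rpredM //.
exact: (maxidealMl maxM).
Qed.

Lemma locmaxMr z w : z \in R -> w \in m -> w * z \in m.
Proof. by rewrite mulrC; apply: locmaxMl. Qed.

Lemma locmax_sub : {subset m <= R}.
Proof.
move=> _ /locmaxP[r [s [Mr As Ms ->]]]; apply/locP; exists r, s.
by rewrite (maxideal_sub maxM).
Qed.

Lemma Aint_loc : {subset Aint <= R}.
Proof.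
by move=> z Az; apply/locP; exists z, 1; rewrite rpred1 divr1 maxidealN1.
Qed.

Lemma maxideal_locmax : {subset M <= m}.
Proof.
by move=> z Az; apply/locmaxP; exists z, 1; rewrite rpred1 divr1 maxidealN1.
Qed.

(** Independence of the chosen fraction: cross-multiplying puts [r * s'] in [M], which is prime and
    does not contain [s']. *)
Lemma locmax_frac r s :
  r \in Aint -> s \in Aint -> s \notin M -> (r / s \in m) = (r \in M).
Proof.
move=> Ar As Ms; apply/idP/idP=> [/locmaxP[r' [s' [Mr' As' Ms' /eqP]]]|Mr].
  rewrite eqr_div ?maxideal_neq0 // => /eqP Drs.
  have: r * s' \in M by rewrite Drs mulrC (maxidealMl maxM).
  by move/(maxideal_prime maxM Ar As'); rewrite (negPf Ms') orbF.
by apply/locmaxP; exists r, s.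
Qed.

Lemma locmax_Aint r : r \in Aint -> (r \in m) = (r \in M).
Proof. by move=> Ar; rewrite -{1}[r]divr1 locmax_frac ?rpred1 ?maxidealN1. Qed.

Lemma locmaxN1 : 1 \notin m.
Proof. by rewrite locmax_Aint ?rpred1 ?maxidealN1. Qed.

Lemma loc_unit z : z \in R -> z \notin m -> z^-1 \in R.
Proof.
move=> /locP[r [s [Ar As Ms ->]]]; rewrite locmax_frac // => Mr.
by apply/locP; exists s, r; rewrite invf_div.
Qed.

Lemma locmax_prime z w : z \in R -> w \in R -> z * w \in m -> (z \in m) || (w \in m).
Proof.
move=> Rz Rw mzw; case: (boolP (z \in m)) => //= mz.
have nz_z : z != 0.
  by apply: contraNneq mz => ->; case: locmax_zmod.
by rewrite -[w](mulKf nz_z) locmaxMl ?loc_unit.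
Qed.

Lemma nonzero_residue_locmax z : nonzero_residue M z -> z \notin m.
Proof. by case=> r [s [Ar As Mr Ms ->]]; rewrite locmax_frac. Qed.

End Localization.

HB.instance Definition _ M maxM :=
  GRing.isSubringClosed.Build algC (@loc M maxM) (loc_subring maxM).
HB.instance Definition _ M maxM :=
  GRing.isZmodClosed.Build algC (@locmax M maxM) (locmax_zmod maxM).

(** * Residue characteristic p: integers, nilpotence modulo p, roots of unity *)

Section ResidueChar.

Variables (M : {pred algC}) (maxM : Aint_maximal_ideal M).
Variables (p : nat) (p_pr : prime p) (pM : p%:R \in M).
Local Notation R := (loc maxM).
Local Notation m := (locmax maxM).

(** An integer of [M] prime to [p] would, by Bezout, put 1 in [M]. *)
Lemma int_maxideal (c : int) : (c%:~R \in M) = (p %| c)%Z.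
Proof.
apply/idP/idP=> [Mc | /dvdzP[q ->]]; last first.
  by rewrite rmorphM /= (maxidealMl maxM) ?Aint_int.
apply: contraT; rewrite dvdzE /= -prime_coprime // => co_pc.
have: coprimez p c by rewrite coprimezE.
move/coprimezP=> [[u v] /= Duv]; case/negP: (maxidealN1 maxM).
rewrite -[1]/(1%:~R) -Duv rmorphD !rmorphM /=.
by apply: (maxidealD maxM); apply: (maxidealMl maxM); rewrite ?Aint_int.
Qed.

(* Reduce an integral equation of [r] modulo [p] and divide out the largest
   power of ['X]: what remains of it is invertible at [r]. *)
Lemma maxideal_nilp r : r \in M -> exists n, r ^+ n / p%:R \in R.
Proof.
move=> Mr; have Ar := maxideal_sub maxM Mr.
have nz_p : p%:R != 0 :> algC by rewrite pnatr_eq0 -lt0n prime_gt0.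
have [q mon_q qr0]: exists2 q : {poly int},
    lead_coef q = 1 & root (map_poly intr q) r.
  have /floorpP[q Dq] := Ar; exists q; last by rewrite -Dq root_minCpoly.
  have /monicP := minCpoly_monic r.
  rewrite Dq lead_coef_map_inj ?mulr0z //; last exact: intr_inj.
  by move/(@intr_inj algC _ 1).
have ex_k: exists k, ~~ (p %| q`_k)%Z.
  exists (size q).-1; rewrite -lead_coefE mon_q.
  by rewrite dvdzE /= dvdn1; case: eqP p_pr => // ->.
case: (ex_minnP ex_k) => k nz_qk min_k; exists k.
have lt_kq: (k < size q)%N.
  by rewrite ltnNge; apply: contra nz_qk => /(nth_default 0)->; rewrite dvdz0.
have [d Dd]: exists d, size q = (k + d.+1)%N.
  by exists (size q - k).-1; rewrite prednK ?subn_gt0 // subnKC // ltnW.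
pose u := \sum_(i < d.+1) (q`_(k + i))%:~R * r ^+ i : algC.
have Du: r ^+ k * u = - \sum_(i < k) (q`_i)%:~R * r ^+ i.
  apply/eqP; rewrite -addr_eq0 addrC; apply/eqP.
  move: qr0; rewrite /root horner_poly Dd big_split_ord /= => /eqP; apply: etrans.
  congr (_ + _); rewrite /u mulr_sumr; apply: eq_bigr => i _.
  by rewrite mulrCA exprD.
have Au: u \in Aint.
  by rewrite rpred_sum // => i _; rewrite rpredM ?rpredX ?Aint_int.
(* Modulo [M] only the constant term of [u] survives, as [r] lies in [M]; that term is an integer
   prime to [p]. *)
have Mu: u \notin M.
  rewrite /u big_ord_recl /= addn0 expr0 mulr1.
  apply: contra nz_qk; rewrite -int_maxideal => Mu.
  rewrite -[_%:~R](addrK (\sum_(i < d) (q`_(k + bump 0 i))%:~R * r ^+ bump 0 i)).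
  apply: (maxidealB maxM Mu); apply: (maxideal_sum maxM) => i _.
  apply: (maxidealMl maxM); first exact: Aint_int.
  by rewrite exprSr; apply: (maxidealMl maxM); rewrite ?rpredX.
have nz_u: u != 0 by apply: contraNneq Mu => ->; apply: (maxideal0 maxM).
rewrite -[r ^+ k](mulfK nz_u) Du mulrAC mulNr mulr_suml mulNr rpredN.
have Ru: u^-1 \in R.
  by apply: loc_unit; [apply: Aint_loc | rewrite locmax_Aint].
rewrite rpredM // rpred_sum // => i _.
have: (p %| q`_i)%Z by apply: contraT => /min_k; rewrite leqNgt ltn_ord.
case/dvdzP=> c ->; rewrite rmorphM /= -pmulrn [X in X / _]mulrAC mulfK //.
by rewrite rpredM ?rpredX ?(Aint_loc _ Ar) // Aint_loc ?Aint_int.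
Qed.

Lemma natr_loc_unit n : ~~ (p %| n)%N -> n%:R^-1 \in R.
Proof.
move=> p'n; rewrite loc_unit ?rpred_nat // locmax_Aint ?Aint_Cnat ?natr_nat //.
by rewrite pmulrn int_maxideal dvdzE.
Qed.

(** Some power of [z] is divisible by [p]; its [logn p n]-th power absorbs the [p]-part of [n], and
    the remaining factor of [n] is a unit of [R]. *)
Lemma locmax_nilp z n : z \in m -> (n > 0)%N -> exists k, z ^+ k / n%:R \in R.
Proof.
case/locmaxP=> r [s [Mr As Ms ->]] n_gt0.
have [k Rk] := maxideal_nilp Mr.
have Rs: s^-1 \in R by rewrite loc_unit ?locmax_Aint ?Aint_loc.
have {}Rk: (r / s) ^+ k / p%:R \in R.
  by rewrite expr_div_n mulrAC rpredM // -exprVn rpredX.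
exists (k * logn p n)%N.
have Dn: n = (p ^ logn p n * n`_p^')%N.
  by rewrite -p_part partnC.
rewrite {2}Dn natrM natrX invfM mulrA exprM -expr_div_n rpredM ?rpredX //.
by rewrite natr_loc_unit // -p'natE ?part_pnat.
Qed.

Lemma locmax_nat : p%:R \in m.
Proof. exact: maxideal_locmax. Qed.

(** By the binomial theorem [(1 - z) ^+ p] is [1 + (-1) ^+ p] modulo [p], which is 0 for odd [p] and
    [p] itself for [p = 2]; then [M] is prime. *)
Lemma unity_root_locmax z : z ^+ p = 1 -> 1 - z \in m.
Proof.
move=> zp1; have Az: z \in Aint.
  by apply: (@Aint_unity_root p); rewrite ?prime_gt0 //; apply/unity_rootP.
rewrite locmax_Aint ?rpredB ?rpred1 //.
apply: (@maxidealX M maxM _ p); first by rewrite rpredB ?rpred1.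
rewrite exprBn -(prednK (prime_gt0 p_pr)) big_ord_recl big_ord_recr /=.
rewrite /bump /= add1n prednK ?prime_gt0 // subn0 expr0 expr1n !mulr1 bin0.
rewrite subnn zp1 binn expr0 !mulr1 !mulr1n addrCA.
apply: (maxidealD maxM); last first.
  case: (even_prime p_pr) => [Dp|odd_p].
    by rewrite Dp sqrrN expr1n -[1 + 1]/(2%:R) -Dp.
  by rewrite -signr_odd odd_p expr1 subrr (maxideal0 maxM).
apply: (maxideal_sum maxM) => i _.
have /dvdnP[c ->]: (p %| 'C(p, 1 + i))%N.
  by rewrite prime_dvd_bin //= -[X in (_ < X)%N]prednK ?prime_gt0 // ltnS.
rewrite -mulr_natl natrM -mulrA; apply: (maxidealMl maxM).
  by rewrite Aint_Cnat ?natr_nat.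
rewrite mulrC; apply: (maxidealMl maxM) => //.
by rewrite !rpredM ?rpredX ?rpredN ?rpred1.
Qed.

End ResidueChar.

(** * Central elements of the group algebra *)

Section Spectral.

Variables (gT : finGroupType) (H : {group gT}).
Implicit Types (w : Iirr H -> algC) (u z a b : gT) (i j : Iirr H).

(* Coefficient at [z] of the central element of the complex group algebra whose
   central character values ['omega_i] are [w i]. *)
Definition central_coef w z : algC :=
  #|H|%:R^-1 * \sum_i w i * 'chi_i 1%g * 'chi_i z^-1%g.

Lemma central_coef_eq w w' : w =1 w' -> central_coef w =1 central_coef w'.
Proof.
move=> eqw z; rewrite /central_coef; congr (_ * _).
by apply: eq_bigr => i _; rewrite eqw.
Qed.

Lemma central_coefJ w z b : b \in H -> central_coef w (z ^ b) = central_coef w z.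
Proof.
move=> Hb; rewrite /central_coef; congr (_ * _).
by apply: eq_bigr => i _; rewrite -conjVg cfunJ.
Qed.

Lemma central_coef_mulC w a b :
  a \in H -> central_coef w (a * b)%g = central_coef w (b * a)%g.
Proof. by move=> Ha; rewrite -(central_coefJ w _ Ha) conjgE mulgA mulKg. Qed.

Lemma central_coef_out w z : z \notin H -> central_coef w z = 0.
Proof.
move=> Hz; rewrite /central_coef big1 ?mulr0 // => i _.
by rewrite [X in _ * X]cfun0 ?mulr0 ?groupV.
Qed.

Lemma central_coefZ c w z :
  central_coef (fun i => c * w i) z = c * central_coef w z.
Proof.
rewrite /central_coef mulrCA [c * _]mulr_sumr; congr (_ * _).
by apply: eq_bigr => i _; rewrite !mulrA.
Qed.

Lemma central_coefB w w' z :
  central_coef (fun i => w i - w' i) z = central_coef w z - central_coef w' z.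
Proof.
rewrite /central_coef -mulrBr -sumrB; congr (_ * _).
by apply: eq_bigr => i _; rewrite !mulrBl.
Qed.

(** Central characters are multiplicative and the product of the group algebra is convolution;
    generalized orthogonality removes the pairs with distinct [i] and [j]. *)
Lemma central_coefM w w' z :
  central_coef (fun i => w i * w' i) z =
    \sum_(u in H) central_coef w u * central_coef w' (u^-1 * z)%g.
Proof.
have nzH : #|H|%:R != 0 :> algC by rewrite pnatr_eq0 -lt0n.
have termE u i j : u \in H ->
    (w i * 'chi_i 1%g * 'chi_i u^-1%g) *
      (w' j * 'chi_j 1%g * 'chi_j (u^-1 * z)^-1%g)
  = w i * w' j * 'chi_i 1%g * 'chi_j 1%g * ('chi_j (u * z^-1)%g * 'chi_i u^-1%g).
  move=> Hu; have ->: 'chi_j (u^-1 * z)^-1%g = 'chi_j (u * z^-1)%g.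
    by rewrite invMg invgK -(cfunJ 'chi_j (u * z^-1)%g Hu) conjgE mulgA mulKg.
  by ring.
transitivity (#|H|%:R^-1 * \sum_i \sum_j w i * w' j * 'chi_i 1%g * 'chi_j 1%g *
   (#|H|%:R^-1 * \sum_(u in H) 'chi_j (u * z^-1)%g * 'chi_i u^-1%g)).
  congr (_ * _); apply: eq_bigr => i _.
  rewrite (bigD1 i) //= [X in _ + X]big1 => [|j ne_ji].
    rewrite generalized_orthogonality_relation eqxx mul1r addr0.
    by field; apply: irr1_neq0.
  by rewrite generalized_orthogonality_relation (negPf ne_ji) mul0r mulr0.
rewrite mulr_sumr; under [RHS]eq_bigr => u Hu.
  rewrite /central_coef mulrACA mulr_suml mulr_sumr.
  under eq_bigr => i _ do rewrite mulr_sumr mulr_sumr; over.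
rewrite exchange_big; apply: eq_bigr => i _ /=; rewrite exchange_big mulr_sumr.
apply: eq_bigr => j _ /=; rewrite !mulr_sumr; apply: eq_bigr => u Hu.
by rewrite termE //; ring.
Qed.

Lemma sum_irr_class a u : a \in H ->
  \sum_(i : Iirr H) 'chi_i a * 'chi_i u^-1%g = #|'C_H[a]|%:R *+ (u \in a ^: H).
Proof.
move=> Ha; have [Hu|notHu] := boolP (u \in H); last first.
  rewrite big1 => [|i _]; last by rewrite [X in _ * X]cfun0 ?mulr0 ?groupV.
  by rewrite (contraNF (subsetP (class_subG Ha (subxx H)) u)).
rewrite class_sym -second_orthogonality_relation //.
by apply: eq_bigr => i _; rewrite irr_inv.
Qed.

Lemma central_coef1 z : central_coef (fun=> 1) z = (z == 1%g)%:R.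
Proof.
have nzH : #|H|%:R != 0 :> algC by rewrite pnatr_eq0 -lt0n.
rewrite /central_coef; under eq_bigr => i _ do rewrite mul1r.
rewrite sum_irr_class // class1G inE; case: eqP; rewrite ?mulr0n ?mulr0 //.
by rewrite cent11T setIT mulr1n mulVf.
Qed.

(** The values are those of [#|'C_H[a]|] times the class sum of [a]; this is the second
    orthogonality relation. *)
Lemma central_coef_class a z : a \in H ->
  central_coef (fun i => #|H|%:R * 'chi_i a / 'chi_i 1%g) z =
    #|'C_H[a]|%:R *+ (z \in a ^: H).
Proof.
move=> Ha; have nzH : #|H|%:R != 0 :> algC by rewrite pnatr_eq0 -lt0n.
rewrite -sum_irr_class // /central_coef mulr_sumr; apply: eq_bigr => i _.
by field; rewrite irr1_neq0.
Qed.

Lemma central_coef_omega (k : 'I_#|classes H|) z :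
  central_coef (fun i => 'omega_i['K_k]) z = (z \in enum_val k)%:R.
Proof.
have nzH : #|H|%:R != 0 :> algC by rewrite pnatr_eq0 -lt0n.
have /imsetP[a Ha Dk] := enum_valP k.
have nzC : #|'C_H[a]|%:R != 0 :> algC by rewrite pnatr_eq0 -lt0n cardG_gt0.
have DH : #|H|%:R = #|'C_H[a]|%:R * #|a ^: H|%:R :> algC.
  by rewrite -natrM -index_cent1 Lagrange ?subsetIl.
rewrite (@central_coef_eq _
  (fun i => #|'C_H[a]|%:R^-1 * (#|H|%:R * 'chi_i a / 'chi_i 1%g))) => [|i].
  by rewrite central_coefZ central_coef_class // Dk mulrnAr mulVf.
rewrite (gring_mode_class_sum_eq i (g := a)) ?Dk ?class_refl // DH.
by field; rewrite irr1_neq0.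
Qed.

Lemma central_coefK w i :
  w i = \sum_(u in H) central_coef w u * 'chi_i u / 'chi_i 1%g.
Proof.
have nzH : #|H|%:R != 0 :> algC by rewrite pnatr_eq0 -lt0n.
apply/esym; rewrite /central_coef.
under eq_bigr => u _ do rewrite -mulrA -mulrA mulr_suml mulr_sumr.
rewrite exchange_big (bigD1 i) //= [X in _ + X]big1 => [|j ne_ji].
  transitivity (w i * (#|H|%:R^-1 * \sum_(u in H) 'chi_i u * 'chi_i u^-1%g)).
    rewrite addr0 !mulr_sumr; apply: eq_bigr => u _; field.
    by rewrite nzH irr1_neq0.
  by rewrite first_orthogonality_relation eqxx mulr1.
transitivity (w j * 'chi_j 1%g / 'chi_i 1%g *
  (#|H|%:R^-1 * \sum_(u in H) 'chi_i u * 'chi_j u^-1%g)).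
  by rewrite !mulr_sumr; apply: eq_bigr => u _; field; rewrite nzH irr1_neq0.
by rewrite first_orthogonality_relation eq_sym (negPf ne_ji) mulr0.
Qed.

(** Fourier inversion: any class function, such as the restriction of a block idempotent to a
    centralizer, comes from a family of central character values. *)
Lemma central_coef_cfun (f : gT -> algC) z :
    {in H &, forall u b, f (u ^ b)%g = f u} -> z \in H ->
  central_coef (fun i => \sum_(u in H) f u * 'chi_i u / 'chi_i 1%g) z = f z.
Proof.
move=> fJ Hz; have nzH : #|H|%:R != 0 :> algC by rewrite pnatr_eq0 -lt0n.
transitivity (#|H|%:R^-1 *
  \sum_(u in H) f u * \sum_(i : Iirr H) 'chi_i u * 'chi_i z^-1%g).
  congr (_ * _); under [RHS]eq_bigr => u _ do rewrite mulr_sumr.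
  rewrite [RHS]exchange_big; apply: eq_bigr => i _ /=.
  by rewrite !mulr_suml; apply: eq_bigr => u _; field; rewrite irr1_neq0.
rewrite (eq_bigr (fun u => if u \in z ^: H then f z * #|'C_H[z]|%:R else 0)).
  rewrite -big_mkcondr (eq_bigl [in z ^: H]) => [|u]; last first.
    rewrite andb_idl // => /imsetP[b Hb ->]; exact: groupJ.
  rewrite sumr_const -[_ *+ #|z ^: H|]mulr_natr -mulrA -natrM -index_cent1.
  rewrite Lagrange ?subsetIl //.
  by rewrite mulrCA mulVf ?mulr1.
move=> u Hu; rewrite sum_irr_class // class_sym.
case: ifP => [/imsetP[b Hb ->] | _]; rewrite ?mulr0 // fJ //.
by rewrite -{1}(conjGid Hb) cent1J -conjIg cardJg.
Qed.

End Spectral.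

(** * The centre of the group algebra over the local ring, seen through central character values *)

Section CentralLattice.

Variables (M : {pred algC}) (maxM : Aint_maximal_ideal M).
Variables (gT : finGroupType) (H : {group gT}).
Local Notation R := (loc maxM).
Local Notation m := (locmax maxM).
Implicit Types (w : Iirr H -> algC) (i j : Iirr H).

Definition central_loc w := forall z, central_coef w z \in R.
Definition central_locmax w := forall z, central_coef w z \in m.

Lemma central_loc_eq w w' : w =1 w' -> central_loc w -> central_loc w'.
Proof. by move=> eqw Lw z; rewrite -(central_coef_eq eqw). Qed.

Lemma central_locmax_eq w w' : w =1 w' -> central_locmax w -> central_locmax w'.
Proof. by move=> eqw Lw z; rewrite -(central_coef_eq eqw). Qed.

Lemma central_loc1 : central_loc (fun=> 1).
Proof. by move=> z; rewrite central_coef1 rpred_nat. Qed.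

Lemma central_locM w w' :
  central_loc w -> central_loc w' -> central_loc (fun i => w i * w' i).
Proof.
by move=> Lw Lw' z; rewrite central_coefM rpred_sum // => u _; rewrite rpredM.
Qed.

Lemma central_locB w w' :
  central_loc w -> central_loc w' -> central_loc (fun i => w i - w' i).
Proof. by move=> Lw Lw' z; rewrite central_coefB rpredB. Qed.

Lemma central_locZ c w : c \in R -> central_loc w -> central_loc (fun i => c * w i).
Proof. by move=> Rc Lw z; rewrite central_coefZ rpredM. Qed.

Lemma central_locX w n : central_loc w -> central_loc (fun i => w i ^+ n).
Proof.
move=> Lw; elim: n => [|n IHn].
  by apply: central_loc_eq central_loc1 => i; rewrite expr0.
by apply: central_loc_eq (central_locM Lw IHn) => i; rewrite exprS.
Qed.

Lemma central_loc_prod I (r : seq I) (P : pred I) (F : I -> Iirr H -> algC) :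
    (forall k, P k -> central_loc (F k)) ->
  central_loc (fun i => \prod_(k <- r | P k) F k i).
Proof.
move=> LF; elim: r => [|k r IHr].
  by apply: central_loc_eq central_loc1 => i; rewrite big_nil.
case Pk: (P k); last by apply: central_loc_eq IHr => i; rewrite big_cons Pk.
by apply: central_loc_eq (central_locM (LF k Pk) IHr) => i; rewrite big_cons Pk.
Qed.

Lemma central_loc_omega (k : 'I_#|classes H|) :
  central_loc (fun i => 'omega_i['K_k]).
Proof. by move=> z; rewrite central_coef_omega rpred_nat. Qed.

Lemma central_locmaxM w w' :
  central_loc w -> central_locmax w' -> central_locmax (fun i => w i * w' i).
Proof.
move=> Lw Lw' z; rewrite central_coefM rpred_sum // => u _.
exact: locmaxMl.
Qed.

Lemma central_locmaxB w w' :
  central_locmax w -> central_locmax w' -> central_locmax (fun i => w i - w' i).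
Proof. by move=> Lw Lw' z; rewrite central_coefB rpredB. Qed.

Lemma central_locmaxN w : central_locmax w -> central_locmax (fun i => - w i).
Proof.
move=> Lw z; rewrite (@central_coef_eq _ _ _ (fun i => -1 * w i)) => [|i].
  by rewrite central_coefZ mulN1r rpredN.
by rewrite mulN1r.
Qed.

(** Grouping by classes turns the cofactors into central character values of class sums, which are
    algebraic integers; a single ['chi_i u / 'chi_i 1%g] need not be one. *)
Lemma central_coef_sum_classes w i :
  w i = \sum_(xH in classes H) central_coef w (repr xH) *
          (#|xH|%:R * 'chi_i (repr xH) / 'chi_i 1%g).
Proof.
rewrite {1}(central_coefK w i).
rewrite (sum_by_classes (F := fun u => central_coef w u * 'chi_i u / 'chi_i 1%g)).
  by apply: eq_bigr => xH _; ring.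
by move=> u b Hu Hb; rewrite /= central_coefJ ?cfunJ.
Qed.

Lemma class_omega_loc xH i : xH \in classes H ->
  #|xH|%:R * 'chi_i (repr xH) / 'chi_i 1%g \in R.
Proof.
case/repr_classesP=> Hx {1}->.
by apply: Aint_loc; apply: Aint_class_div_irr1.
Qed.

Lemma central_loc_val w i : central_loc w -> w i \in R.
Proof.
move=> Lw; rewrite central_coef_sum_classes rpred_sum // => xH HxH.
by rewrite rpredM ?class_omega_loc.
Qed.

Lemma central_locmax_val w i : central_locmax w -> w i \in m.
Proof.
move=> Lw; rewrite central_coef_sum_classes rpred_sum // => xH HxH.
by apply: locmaxMr; rewrite ?class_omega_loc.
Qed.

Lemma central_loc_small w : (forall i, w i / #|H|%:R \in R) -> central_loc w.
Proof.
move=> Rw z; rewrite /central_coef mulr_sumr rpred_sum // => i _.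
rewrite !mulrA [_ * w i]mulrC; have RwH := Rw i.
by apply: rpredM; [apply: rpredM => // | ]; rewrite Aint_loc ?Aint_irr.
Qed.

Lemma locX1B z n : z \in R -> exists2 u, u \in R & 1 - (1 - z) ^+ n = z * u.
Proof.
move=> Rz; exists (\sum_(k < n) (1 - z) ^+ k).
  by rewrite rpred_sum // => k _; rewrite rpredX ?rpredB ?rpred1.
by rewrite -{1}[1](expr1n _ n) subrXX opprB addrC subrK;
   congr (_ * _); apply: eq_bigr => k _; rewrite expr1n mul1r.
Qed.

End CentralLattice.

(** * Lifting of central idempotents *)

Section IdempotentLifting.

Variables (p : nat) (p_pr : prime p).
Variables (M : {pred algC}) (maxM : Aint_maximal_ideal M) (pM : p%:R \in M).
Variables (gT : finGroupType) (H : {group gT}).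
Local Notation R := (loc maxM).
Local Notation m := (locmax maxM).

Lemma locmax_nilp_le z N : z \in m -> (N > 0)%N ->
  exists k, forall n, (k <= n)%N -> z ^+ n / N%:R \in R.
Proof.
move=> mz N_gt0; have [k Rk] := locmax_nilp p_pr pM mz N_gt0; exists k => n le_kn.
by rewrite -(subnK le_kn) exprD -mulrA rpredM ?rpredX ?(locmax_sub mz).
Qed.

(* [1 - (1 - X ^ n) ^ n] is divisible by [X ^ n] and is [1] modulo
   [(1 - X) ^ n]: for large [n] it maps [w] to the idempotent up to [p #|H| R]. *)
Lemma central_idem_lift (w : Iirr H -> algC) (S : {set Iirr H}) :
    central_loc maxM w ->
    (forall i, i \in S -> 1 - w i \in m) -> (forall i, i \notin S -> w i \in m) ->
  central_loc maxM (fun i => (i \in S)%:R) /\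
  (central_locmax maxM (fun i => w i * w i - w i) ->
     central_locmax maxM (fun i => (i \in S)%:R - w i)).
Proof.
move=> Lw Sw S'w; have Rw i := central_loc_val i Lw.
have pH_gt0: (p * #|H| > 0)%N by rewrite muln_gt0 prime_gt0 ?cardG_gt0.
have ex_n i: exists k, forall n, (k <= n)%N ->
    (if i \in S then 1 - w i else w i) ^+ n / (p * #|H|)%:R \in R.
  by apply: locmax_nilp_le; rewrite // fun_if; case: ifP => [/Sw | /negbT/S'w].
have [k Rk] := fin_all_exists ex_n.
(* One exponent serves all characters; the successor makes it positive, so that [n.-1.+1] is [n]
   below. *)
have [n n_gt0 Rn]: exists2 n, (0 < n)%N & forall i,
    (if i \in S then 1 - w i else w i) ^+ n / (p * #|H|)%:R \in R.
  by exists (\max_i k i).+1 => // i; apply: Rk; rewrite leqW ?leq_bigmax.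
pose P z : algC := 1 - (1 - z ^+ n) ^+ n.
have LP: central_loc maxM (fun i => P (w i)).
  apply: central_locB; first exact: central_loc1.
  apply: central_locX; apply: central_locB; first exact: central_loc1.
  exact: central_locX.
have dP i: ((i \in S)%:R - P (w i)) / (p * #|H|)%:R \in R.
  have:= Rn i; case: ifP => _ Rni; rewrite /P.
    have Rw1: 1 - w i \in R by rewrite rpredB ?rpred1.
    have [u Ru Du] := locX1B n Rw1; rewrite mulr1n subKr.
    rewrite subKr in Du; rewrite Du.
    by rewrite exprMn mulrAC rpredM ?rpredX.
  have [|u Ru ->] := @locX1B _ maxM (w i ^+ n) n; first by rewrite rpredX.
  by rewrite sub0r mulNr rpredN mulrAC rpredM.
(* The factor [#|H|] in [dP] pays for the denominator of [central_coef]; the extra [p] makes the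
   difference vanish modulo [m]. *)
have Lp: central_loc maxM (fun i => p%:R^-1 * ((i \in S)%:R - P (w i))).
  apply: central_loc_small => i.
  by rewrite [_^-1 * _]mulrC -mulrA -invfM -natrM.
have mP: central_locmax maxM (fun i => (i \in S)%:R - P (w i)).
  have nz_p: p%:R != 0 :> algC by rewrite pnatr_eq0 -lt0n prime_gt0.
  move=> z; rewrite (@central_coef_eq _ _ _
     (fun i => p%:R * (p%:R^-1 * ((i \in S)%:R - P (w i))))) => [|i].
    by rewrite central_coefZ locmaxMr ?locmax_nat.
  by rewrite mulVKf.
split=> [|mw].
  have LPS := central_locB LP (fun z => locmax_sub (central_locmaxN mP z)).
  by apply: central_loc_eq LPS => i; ring.
(* Idempotents modulo [m] agree with their positive powers. Applied to [w] and then to [1 - w ^+ n],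
   this gives [P w = w] modulo [m]. *)
have mX (v : Iirr H -> algC) l: central_loc maxM v ->
    central_locmax maxM (fun i => v i * v i - v i) ->
    central_locmax maxM (fun i => v i ^+ l.+1 - v i).
  move=> Lv mv; elim: l => [|l IHl].
    by apply: central_locmax_eq (central_locmaxB mv mv) => i; ring.
  apply: central_locmax_eq (central_locmaxB (central_locmaxM Lv IHl)
    (central_locmaxN mv)) => i.
  by rewrite [_ ^+ l.+2]exprS; ring.
have m1 := mX _ n.-1 Lw mw.
have L1: central_loc maxM (fun i => 1 - w i ^+ n).
  by apply: central_locB; [apply: central_loc1 | apply: central_locX].
have m2: central_locmax maxM
    (fun i => (1 - w i ^+ n) * (1 - w i ^+ n) - (1 - w i ^+ n)).
  have Ln := central_locX n Lw.
  have L2: central_loc maxM (fun i => w i ^+ n + w i - 1).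
    apply: central_loc_eq (central_locB Ln (central_locB (central_loc1 _ _) Lw)) => i.
    by ring.
  (* With [W] for [w ^+ n], the left side is [W * W - W], which equals
     [(W + w - 1) * (W - w) + (w * w - w)]. *)
  apply: central_locmax_eq (central_locmaxB (central_locmaxM L2 m1)
    (central_locmaxN mw)) => i.
  by rewrite prednK //; ring.
have m3 := mX _ n.-1 L1 m2.
apply: central_locmax_eq (central_locmaxB mP (central_locmaxN
  (central_locmaxB (central_locmaxN m3) (central_locmaxN m1)))) => i.
by rewrite /P prednK //; ring.
Qed.

(** Each [j] outside [B] is separated from [B] by some class sum. The normalized difference [f j] is
    0 at [j] and 1 modulo [m] on [B], so the product of these over [j] can be lifted. *)
Lemma block_central_loc (B : {set Iirr H}) :
  is_block M B -> central_loc maxM (fun i => (i \in B)%:R).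
Proof.
case=> i0 DB.
have ex_k j: exists k : 'I_#|classes H|, j \notin B ->
    'omega_i0['K_k] - 'omega_j['K_k] \notin M.
  have [/forallP ? | /forallPn[k Mk]] := boolP (same_block M i0 j).
    (* Default choice for [j] in [B], where no separating class exists. *)
    exists (enum_rank_in (classes1 H) 1%g).
    by rewrite DB inE; case/negP; apply/forallP.
  by exists k.
have [k Mk] := fin_all_exists ex_k.
pose d j := 'omega_i0['K_(k j)] - 'omega_j['K_(k j)].
have Ad j: d j \in Aint by rewrite rpredB ?Aint_gring_mode_class_sum.
have Rd j: j \notin B -> (d j)^-1 \in R.
  by move=> B'j; apply: loc_unit; [apply: Aint_loc | rewrite locmax_Aint ?Mk].
pose f j i := (d j)^-1 * ('omega_i['K_(k j)] - 'omega_j['K_(k j)] * 1).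
pose w i := \prod_(j | j \notin B) f j i.
have Lw: central_loc maxM w.
  apply: central_loc_prod => j B'j; apply: central_locZ; first exact: Rd.
  apply: central_locB; first exact: central_loc_omega.
  apply: central_locZ; last exact: central_loc1.
  exact/Aint_loc/Aint_gring_mode_class_sum.
apply: (proj1 (central_idem_lift Lw _ _)) => i => [Bi | B'i]; last first.
  by rewrite /w (bigD1 i) //= /f mulr1 subrr mulr0 mul0r rpred0.
suffices: \prod_(j | j \notin B) f j i \in R /\ 1 - w i \in m by case.
rewrite /w; elim/big_rec: _ => [|j x B'j [Rx mx]].
  by rewrite rpred1 subrr rpred0.
have mf: 1 - f j i \in m.
  have nz_d: d j != 0.
    by apply: contraNneq (Mk j B'j) => d0; rewrite -/(d j) d0 (maxideal0 maxM).
  have ->: 1 - f j i = (d j)^-1 * ('omega_i0['K_(k j)] - 'omega_i['K_(k j)]).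
    by rewrite /f -{1}(mulVf nz_d) /d; ring.
  apply: locmaxMl; rewrite ?Rd // maxideal_locmax //.
  by move: Bi; rewrite DB inE => /forallP.
have Rf: f j i \in R.
  by rewrite -[f j i](subKr 1) rpredB ?rpred1 ?(locmax_sub mf).
split; first by rewrite rpredM.
rewrite (_ : 1 - f j i * x = 1 - f j i + f j i * (1 - x)); last by ring.
by rewrite rpredD // locmaxMl.
Qed.

End IdempotentLifting.

(** * Block orthogonality for p-sections *)

(** The Leibniz expansions of [\det A] and [\det 1%:M] are compared permutation by permutation,
    factor by factor. *)
Lemma det_locmax (M : {pred algC}) (maxM : Aint_maximal_ideal M) n (A : 'M[algC]_n) :
    (forall i j, (A - 1%:M) i j \in locmax maxM) ->
  1 - \det A \in locmax maxM.
Proof.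
move=> mA; have R1 i j : (1%:M : 'M[algC]_n) i j \in loc maxM.
  by rewrite mxE rpred_nat.
have RA i j : A i j \in loc maxM.
  rewrite -[A i j](subrK (1%:M i j)) rpredD //.
  by have /locmax_sub := mA i j; rewrite !mxE.
rewrite -(det1 _ n) /determinant -sumrB rpred_sum // => s _.
rewrite -mulrBr locmaxMl ?rpredX ?rpredN ?rpred1 //.
suffices [] : [/\ \prod_i (1%:M : 'M[algC]_n) i (s i) \in loc maxM,
  \prod_i A i (s i) \in loc maxM &
  \prod_i (1%:M : 'M[algC]_n) i (s i) - \prod_i A i (s i) \in locmax maxM] by [].
elim/big_rec2: _ => [|i y x _ [Rx Ry mxy]]; first by rewrite rpred1 subrr rpred0.
split; rewrite ?rpredM // -/(_ - _).
have ->: 1%:M i (s i) * x - A i (s i) * y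
   = 1%:M i (s i) * (x - y) - (A - 1%:M) i (s i) * y.
  by rewrite [(A - _) _ _]mxE [(- _ : matrix _ _ _) _ _]mxE; ring.
by apply: rpredB; [apply: locmaxMl | apply: locmaxMr].
Qed.

Section EnumMatrix.

Variables (gT : finGroupType) (H : {group gT}).

Definition enum_mx (F : gT -> gT -> algC) : 'M_#|H| :=
  \matrix_(i, j) F (enum_val i) (enum_val j).

Lemma enum_mxM F1 F2 :
  enum_mx F1 *m enum_mx F2 = enum_mx (fun x y => \sum_(u in H) F1 x u * F2 u y).
Proof.
apply/matrixP=> i j; rewrite !mxE [RHS]big_enum_val.
by apply: eq_bigr => k _; rewrite !mxE.
Qed.

Lemma enum_mx_tr F : \tr (enum_mx F) = \sum_(u in H) F u u.
Proof. by rewrite big_enum_val; apply: eq_bigr => k _; rewrite mxE. Qed.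

Lemma eq_enum_mx F1 F2 : {in H &, forall x y, F1 x y = F2 x y} ->
  enum_mx F1 = enum_mx F2.
Proof. by move=> eqF; apply/matrixP=> i j; rewrite !mxE eqF ?enum_valP. Qed.

Lemma enum_mx1 : enum_mx (fun x y => (x == y)%:R) = 1%:M.
Proof. by apply/matrixP=> i j; rewrite !mxE (inj_eq enum_val_inj). Qed.

End EnumMatrix.

Section BlockOrthogonality.

Variables (p : nat) (p_pr : prime p).
Variables (M : {pred algC}) (maxM : Aint_maximal_ideal M) (pM : p%:R \in M).
Variables (gT : finGroupType) (H : {group gT}).
Local Notation R := (loc maxM).
Local Notation m := (locmax maxM).

(** [L] is prime to [#[s] * #[t]], so a Bezout exponent [v] undoes the [L]-th power on both
    elements. *)
Lemma expg_p'_inj L (s t : gT) :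
  p.-elt s -> p.-elt t -> ~~ (p %| L)%N -> (s ^+ L = t ^+ L)%g -> s = t.
Proof.
move=> ps pt p'L eq_st.
have L_gt0: (0 < L)%N by case: L p'L {eq_st}; rewrite ?dvdn0.
have p'Ln: p^'.-nat L by rewrite p'natE.
have co_LN: gcdn L (#[s] * #[t]) = 1%N.
  apply/eqP; rewrite -/(coprime L _) coprime_sym (pnat_coprime _ p'Ln) //.
  by rewrite pnatM; apply/andP.
have [u _ /dvdnP[v Dv]] := Bezoutl (#[s] * #[t]) L_gt0.
have expE (z : gT) : (z ^+ (#[s] * #[t]) = 1 -> z = (z ^+ L) ^+ v)%g.
  by move=> z1; rewrite -expgM mulnC -Dv co_LN expgD mulnC expgM z1 expg1n mulg1.
have s1: (s ^+ (#[s] * #[t]) = 1)%g by rewrite expgM expg_order expg1n.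
have t1: (t ^+ (#[s] * #[t]) = 1)%g by rewrite mulnC expgM expg_order expg1n.
by rewrite [LHS](expE s s1) eq_st -(expE t t1).
Qed.

(** The equation says that [r] is fixed by the [L]-th iterate of [x |-> a * x * b^-1]. For [L] prime
    to [p], taking [p]-parts and extracting [L]-th roots would make [r] conjugate the [p]-part of
    [a] to that of [b]. *)
Lemma dvdn_orbit_twist (a b : gT) (L : nat) (r : gT) :
    r \in H -> a.`_p \notin b.`_p ^: H ->
    (a ^+ L * r = r * b ^+ L)%g -> (p %| L)%N.
Proof.
move=> Hr not_conj eqL; apply: contraR not_conj => p'L.
rewrite class_sym; apply/imsetP; exists r => //.
apply: (@expg_p'_inj L) => //; rewrite ?p_eltJ ?p_elt_constt //.
by rewrite -consttJ -!consttX -conjXg conjgE eqL mulKg.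
Qed.

(** [d x] is the position of [x] on its [tau]-orbit, counted from the root of the orbit. *)
Lemma orbit_root_of_unity_twist (a b : gT) (zeta : algC) :
    a \in H -> b \in H -> a.`_p \notin b.`_p ^: H -> zeta ^+ p = 1 ->
  exists d : gT -> nat,
    {in H, forall x, zeta ^+ d (a * x * b^-1)%g = zeta * zeta ^+ d x}.
Proof.
move=> Ha Hb not_conj zp1; pose tau x := (a * x * b^-1)%g.
have tau_inj: injective tau by move=> x y /mulIg/mulgI.
have iter_tau n x : iter n tau x = (a ^+ n * x * b ^- n)%g.
  elim: n => [|n IHn] /=; first by rewrite !expg0 invg1 mul1g mulg1.
  by rewrite IHn /tau !expgS invMg !mulgA.
exists (fun x => findex tau (froot tau x) x) => x Hx; rewrite -/(tau x).
have sym_tau := fconnect_sym tau_inj.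
have r_x: fconnect tau (froot tau x) x by rewrite sym_tau connect_root.
have ->: froot tau (tau x) = froot tau x.
  by apply/esym/(fingraph.rootP sym_tau)/fconnect1.
set r := froot tau x in r_x *.
have Hr: r \in H.
  rewrite /r -(iter_findex (connect_root (frel tau) x)) iter_tau.
  by rewrite !groupM ?groupV ?groupX.
have dv_p: (p %| fingraph.order tau r)%N.
  apply: (dvdn_orbit_twist Hr not_conj).
  have := iter_order tau_inj r; rewrite iter_tau => Dr.
  by apply: (mulIg (b ^- fingraph.order tau r)%g); rewrite Dr mulgK.
have Dx := iter_findex r_x; have lt_x := findex_max r_x.
have Dtx: tau x = iter (findex tau r x).+1 tau r by rewrite iterS Dx.
(* From the last point [tau] returns to position 0, which is harmless because [p] divides the orbit
   length. *)
rewrite -exprS Dtx; move: lt_x; rewrite leq_eqVlt => /predU1P[Dk | lt_k].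
  by rewrite Dk iter_order // findex0 expr0; have /dvdnP[c ->] := dv_p;
     rewrite mulnC exprM zp1 expr1n.
by rewrite findex_iter.
Qed.

(** [S] need not be a block: this is also applied in a centralizer, to a lifted idempotent. The sum
    is the trace of [T *m Pi]. *)
Lemma block_class_sum_eq0 (S : {set Iirr H}) (a b : gT) :
    central_loc maxM (fun i => (i \in S)%:R) -> a \in H -> b \in H ->
    a.`_p \notin b.`_p ^: H ->
  \sum_(u in H) central_coef (fun i => (i \in S)%:R) ((a ^ u)^-1 * b)%g = 0.
Proof.
move=> LS Ha Hb not_conj; set e := central_coef _.
have [zeta prim_zeta] := C_prim_root_exists (prime_gt0 p_pr).
have zp1 := prim_expr_order prim_zeta.
have nz1: 1 - zeta != 0.
  rewrite subr_eq0 eq_sym -[zeta]expr1 -(prim_order_dvd prim_zeta) dvdn1.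
  by case: eqP p_pr => // ->.
have [d Dd] := orbit_root_of_unity_twist Ha Hb not_conj zp1.
pose tau x := (a * x * b^-1)%g.
have Htau x : x \in H -> tau x \in H by move=> Hx; rewrite !groupM ?groupV.
(* [Pi] is convolution with the idempotent, [T] the permutation matrix of [tau], [D] the diagonal
   matrix of roots of unity. *)
pose Pi := enum_mx H (fun x y => e (x^-1 * y)%g).
pose T := enum_mx H (fun x y => (y == tau x)%:R).
pose D := enum_mx H (fun x y => (x == y)%:R * zeta ^+ d x).
have ee z : \sum_(u in H) e u * e (u^-1 * z)%g = e z.
  rewrite /e -central_coefM; apply: central_coef_eq => i.
  by rewrite -natrM mulnb andbb.
have PiPi: Pi *m Pi = Pi.
  rewrite enum_mxM; apply: eq_enum_mx => x y Hx Hy.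
  rewrite -(ee (x^-1 * y)%g) (reindex_inj (mulgI x)) /=.
  apply: eq_big => [u | u _]; first by rewrite groupMl.
  by rewrite mulKg invMg mulgA.
have TPi: T *m Pi = enum_mx H (fun x y => e ((tau x)^-1 * y)%g).
  rewrite enum_mxM; apply: eq_enum_mx => x y Hx Hy.
  rewrite (bigD1 (tau x)) ?Htau //= eqxx mul1r big1 ?addr0 // => u.
  by case/andP=> _ /negPf->; rewrite mul0r.
have PiT: Pi *m T = T *m Pi.
  rewrite TPi enum_mxM; apply: eq_enum_mx => x y Hx Hy.
  have Dy: tau (a^-1 * y * b)%g = y by rewrite /tau !mulgA mulgV mul1g mulgK.
  rewrite (bigD1 (a^-1 * y * b)%g) ?groupM ?groupV //= Dy.
  rewrite eqxx mulr1 big1 ?addr0 => [|u].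
    rewrite /tau !invMg invgK -2!mulgA [RHS]central_coef_mulC //.
    by rewrite !mulgA.
  case/andP=> _ ne_u; case: eqP => [Du | _]; last by rewrite mulr0.
  by case/eqP: ne_u; rewrite Du /tau !mulgA mulVg mul1g mulgKV.
have TD: T *m D = zeta *: (D *m T).
  rewrite !enum_mxM; apply/matrixP => i j; rewrite !mxE.
  set x := enum_val i; set y := enum_val j.
  have Hx : x \in H by apply: enum_valP.
  rewrite (bigD1 (tau x)) ?Htau //= eqxx mul1r big1 ?addr0 => [|u]; last first.
    by case/andP=> _ /negPf->; rewrite mul0r.
  rewrite (bigD1 x) //= eqxx mul1r big1 ?addr0 => [|u]; last first.
    by case/andP=> _; rewrite eq_sym => /negPf->; rewrite !mul0r.
  by rewrite [zeta ^+ _]Dd // [tau x == y]eq_sym mulrC mulrA.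
(* The compression of [D], completed by the identity on the complement of the image of [Pi] so that
   a full determinant tests its invertibility. *)
pose X := Pi *m D *m Pi + (1%:M - Pi).
have XPi: X *m Pi = Pi *m D *m Pi.
  by rewrite mulmxDl mulmxBl mul1mx PiPi subrr addr0 -mulmxA PiPi.
have PiX: Pi *m X = Pi *m D *m Pi.
  by rewrite mulmxDr mulmxBr mulmx1 PiPi subrr addr0 !mulmxA PiPi.
have TX: (T *m Pi) *m X = zeta *: (X *m (T *m Pi)).
  have ->: X *m (T *m Pi) = Pi *m (D *m T) *m Pi.
    by rewrite -PiT mulmxA XPi -!mulmxA PiT.
  rewrite -mulmxA PiX !mulmxA -PiT -[Pi *m T *m D]mulmxA TD.
  by rewrite -scalemxAr -scalemxAl !mulmxA.
have uX: X \in unitmx.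
  rewrite unitmxE unitfE; apply: contraTneq (locmaxN1 maxM) => detX0.
  rewrite negbK -[1](subr0) -detX0; apply: det_locmax => i j.
  have ->: X - 1%:M = Pi *m (D - 1%:M) *m Pi.
    by rewrite mulmxBr mulmxBl mulmx1 PiPi /X -addrA [1%:M - Pi]addrC addrK.
  have RPi i' j' : Pi i' j' \in R by rewrite mxE LS.
  rewrite mxE rpred_sum // => k _; rewrite locmaxMr // mxE rpred_sum // => l _.
  rewrite locmaxMl // -enum_mx1 !mxE; case: eqP => _; last first.
    by rewrite mul0r subrr rpred0.
  rewrite mul1r -opprB rpredN (unity_root_locmax maxM p_pr pM) //.
  by rewrite -exprM mulnC exprM zp1 expr1n.
(* By [TX], [T *m Pi] is conjugate under [X] to [zeta] times itself. *)
have tr0: (1 - zeta) * \tr (T *m Pi) = 0.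
  rewrite mulrBl mul1r -{1}[T *m Pi](mulmxK uX) TX -scalemxAl mxtraceZ.
  by rewrite mxtrace_mulC mulKmx // subrr.
move/eqP: tr0; rewrite mulf_eq0 (negPf nz1) TPi enum_mx_tr => /eqP; apply: etrans.
apply: eq_bigr => u Hu; rewrite /e [LHS]central_coef_mulC ?groupV ?groupJ //.
by rewrite /tau conjgE !invMg !invgK !mulgA.
Qed.

(** The fibres of [u |-> a ^ u] are the right cosets of ['C_H[a]]. *)
Lemma sum_conjg (a : gT) (f : gT -> algC) : a \in H ->
  \sum_(u in H) f (a ^ u)%g = \sum_(v in a ^: H) #|'C_H[a]|%:R * f v.
Proof.
move=> Ha; rewrite (partition_big (conjg a) [in a ^: H]) => [|u Hu]; last first.
  exact: memJ_class.
apply: eq_bigr => _ /imsetP[c Hc ->].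
rewrite (eq_bigr (fun=> f (a ^ c)%g)) => [|u /andP[_ /eqP->] //].
rewrite sumr_const mulr_natl; congr (_ *+ _).
rewrite -(card_rcoset 'C_H[a] c); apply: eq_card => u.
have E: (u * c^-1 \in 'C[a])%g = (a ^ u == a ^ c)%g.
  rewrite -(inj_eq (conjg_inj c^-1%g)) -!conjgM mulgV conjg1.
  apply/cent1P/eqP=> [comm | /conjg_fixP/commgP/commute_sym //].
  by apply/conjg_fixP/commgP/commute_sym.
by rewrite mem_rcoset in_setI E groupMr ?groupV // unfold_in.
Qed.

(** Both sides are the coefficient at [b] of the idempotent times [#|'C_H[a]|] class sums of [a],
    found by convolution and from central character values. *)
Lemma block_class_sumE (S : {set Iirr H}) (a b : gT) : a \in H ->
  \sum_(u in H) central_coef (fun i => (i \in S)%:R) ((a ^ u)^-1 * b)%g =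
    \sum_(i in S) 'chi_i a * 'chi_i b^-1%g.
Proof.
move=> Ha; have nzH : #|H|%:R != 0 :> algC by rewrite pnatr_eq0 -lt0n.
pose e z := central_coef (fun i : Iirr H => (i \in S)%:R) z.
rewrite (sum_conjg (fun v => e (v^-1 * b)%g)) //.
transitivity (central_coef
    (fun i : Iirr H => #|H|%:R * 'chi_i a / 'chi_i 1%g * (i \in S)%:R) b).
  rewrite central_coefM big_mkcond [RHS]big_mkcond; apply: eq_bigr => v _ /=.
  rewrite central_coef_class //; case: ifP => [vH | _].
    by rewrite (subsetP (class_subG Ha (subxx H))).
  by rewrite mulr0n mul0r if_same.
rewrite /central_coef mulr_sumr [RHS]big_mkcond; apply: eq_bigr => i _ /=.
by case: ifP => _; rewrite ?mulr0n ?mulr1n; field; rewrite nzH irr1_neq0.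
Qed.

End BlockOrthogonality.

(** * Nonvanishing on the defect group *)

Section Nonvanishing.

Variables (p : nat) (p_pr : prime p).
Variables (M : {pred algC}) (maxM : Aint_maximal_ideal M) (pM : p%:R \in M).
Variable gT : finGroupType.
Implicit Types (G : {group gT}) (A : {set gT}).
Local Notation R := (loc maxM).
Local Notation m := (locmax maxM).

(** Off ['C[x]], the orbits of [<[x]>] have length divisible by [p] and [f] is constant on them, so
    they contribute 0 modulo [m]. *)
Lemma sum_conjg_fix (x : gT) A (f : gT -> algC) :
    p.-elt x -> x \in 'N(A) -> (forall u, f u \in R) ->
    (forall u, f (u ^ x)%g = f u) ->
  \sum_(u in A) f u - \sum_(u in A :&: 'C[x]) f u \in m.
Proof.
move=> p_x NAx Rf fJ; rewrite [X in X - _](big_setID 'C[x]) /= addrC addrK.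
set S := A :\: 'C[x].
have actS: [acts <[x]>, on S | 'J].
  rewrite astabsJ cycle_subG; apply/normP.
  rewrite conjDg (normP NAx) (normP (subsetP (normG _) x _)) //.
  exact/cent1P.
have fX k u : f (u ^ (x ^+ k))%g = f u.
  by elim: k u => [|k IHk] u; rewrite ?expg0 ?conjg1 // expgSr conjgM fJ.
rewrite (set_partition_big _ (orbit_partition actS)) rpred_sum //=.
move=> _ /imsetP[u /setDP[_ not_cxu] ->].
rewrite (eq_bigr (fun=> f u)) => [|_ /orbitP[_ /cycleP[k ->] <-]]; last exact: fX.
rewrite sumr_const -mulr_natr locmaxMl //.
have /p_natP[[|l] Dl]: p.-nat #|orbit 'J <[x]> u|.
- exact: pnat_dvd (dvdn_orbit _ _ _) p_x.
- case/negP: not_cxu; apply/cent1P/commgP/conjg_fixP.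
  have /cards1P[v Dv]: #|orbit 'J <[x]> u| == 1%N by rewrite Dl.
  have orb1 z : z \in orbit 'J <[x]> u -> z = v by rewrite Dv => /set1P.
  rewrite [RHS](orb1 u (orbit_refl _ _ _)); apply: orb1.
  by apply/orbitP; exists x; rewrite ?cycle_id.
- by rewrite Dl expnS natrM locmaxMr ?rpred_nat ?locmax_nat.
Qed.


(** Averaging: conjugation by each [u] in [G] permutes [A], so [#|G|] times the sum is a sum of the
    vanishing inner sums. *)
Lemma central_stable_sum0 G A (f : gT -> algC) : G \subset 'N(A) ->
  {in A, forall a, \sum_(u in G) f (a ^ u)%g = 0} -> \sum_(a in A) f a = 0.
Proof.
move=> nAG f0; have nzG : #|G|%:R != 0 :> algC by rewrite pnatr_eq0 -lt0n.
apply: (mulfI nzG); rewrite mulr0 mulr_natl -sumr_const.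
transitivity (\sum_(u in G) \sum_(a in A) f (a ^ u)%g); last first.
  by rewrite exchange_big big1.
apply: eq_bigr => u Gu; rewrite (reindex_inj (conjg_inj u)) /=.
by apply: eq_bigl => a; rewrite memJ_norm ?(subsetP nAG).
Qed.

Lemma block_nonvanishing G (B : {set Iirr G}) (x g : gT) :
    central_loc maxM (fun i => (i \in B)%:R) ->
    x \in G -> g \in 'C_G[x] -> p.-elt x ->
    central_coef (fun i => (i \in B)%:R) g \notin m ->
  exists2 i, i \in B & 'chi_i x != 0.
Proof.
move=> LB Gx Cg p_x; set e := central_coef _ => e_g; have [Gg cxg] := setIP Cg.
have ex : exists i, (i \in B) && ('chi_i x != 0); last first.
  by have [i /andP[]] := ex; exists i.
apply/existsP; apply: contraR e_g => /existsPn chi0.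
have{}chi0 i : i \in B -> 'chi_i x = 0.
  by move=> Bi; have:= chi0 i; rewrite Bi negbK => /eqP.
have nzG : #|G|%:R != 0 :> algC by rewrite pnatr_eq0 -lt0n.
have eJ u v : v \in G -> e (u ^ v)%g = e u by apply: central_coefJ.
(* If [g] is not [p]-regular, the vanishing theorem for 1 and [g] already gives [e g = 0]. Otherwise
   [x] is the [p]-part of [z = x * g]. *)
have [p'g | not_p'g] := boolP (g.`_p == 1%g); last first.
  have := @block_class_sum_eq0 _ p_pr _ maxM pM _ G B 1%g g LB (group1 G) Gg.
  rewrite constt1 class_sym class1G inE => /(_ not_p'g).
  under eq_bigr => u _ do rewrite conj1g invg1 mul1g.
  rewrite sumr_const -mulr_natr => /eqP.
  by rewrite mulf_eq0 (negPf nzG) orbF => /eqP; rewrite -/(e g) => ->; rewrite rpred0.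
pose C := 'C_G[x]%G; pose z := (x * g)%g.
have sCG : C \subset G := subsetIl _ _.
have Cx : x \in C by rewrite inE Gx cent1id.
have Cz : z \in C by rewrite groupM.
have cC u : u \in C -> commute u x by case/setIP=> _ /cent1P.
pose f u := e (u^-1 * z)%g.
have mf : \sum_(u in x ^: G :&: C) f u \in m.
  have: \sum_(u in G) f (x ^ u)%g = 0.
    by rewrite block_class_sumE // big1 // => i /chi0->; rewrite mul0r.
  rewrite sum_conjg // -mulr_sumr => /eqP; rewrite mulf_eq0 pnatr_eq0.
  rewrite -[_ == 0%N]negbK -lt0n cardG_gt0 /= => /eqP sf0.
  have -> : x ^: G :&: C = x ^: G :&: 'C[x].
    by rewrite setIA (setIidPl (class_subG Gx (subxx G))).
  have fJ u : f (u ^ x)%g = f u.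
    rewrite /f -[RHS](eJ _ x Gx) conjMg conjVg; congr (e (_ * _)%g).
    by apply/esym/conjg_fixP/commgP/cC.
  have Rf u : f u \in R by apply: LB.
  have Nx := subsetP (class_norm x G) x Gx.
  by have:= sum_conjg_fix p_x Nx Rf fJ; rewrite sf0 sub0r rpredN.
(* Central character values of the restriction of [e] to [C]. *)
pose w (i : Iirr C) := \sum_(u in C) e u * 'chi_i u / 'chi_i 1%g.
have cw u : u \in C -> central_coef w u = e u.
  move=> Cu; apply: central_coef_cfun => // v b _ Cb.
  by apply: eJ; apply: (subsetP sCG).
have Lw : central_loc maxM w.
  move=> u; have [Cu | C'u] := boolP (u \in C); last by rewrite central_coef_out ?rpred0.
  by rewrite cw.
have ee u : \sum_(v in G) e v * e (v^-1 * u)%g = e u.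
  rewrite /e -central_coefM; apply: central_coef_eq => i.
  by rewrite -natrM mulnb andbb.
(* For [u] in [C], the convolution square of [e] over [G] reduces modulo [m] to the sum over [C], by
   conjugation with [x]. *)
have mw : central_locmax maxM (fun i => w i * w i - w i).
  move=> u; have [Cu | C'u] := boolP (u \in C); last by rewrite central_coef_out ?rpred0.
  pose h v := e v * e (v^-1 * u)%g.
  have hJ v : h (v ^ x)%g = h v.
    rewrite /h eJ // -[in RHS](eJ (v^-1 * u)%g x Gx) conjMg conjVg.
    by congr (_ * e (_ * _)%g); apply/esym/conjg_fixP/commgP/cC.
  have Rh v : h v \in R by rewrite rpredM ?LB.
  have := sum_conjg_fix p_x (subsetP (normG G) x Gx) Rh hJ.
  rewrite ee -rpredN opprB => mh.
  rewrite central_coefB central_coefM cw // (eq_bigr h) // => v Cv.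
  by congr (_ * _); apply: cw; rewrite ?groupM ?groupV.
pose S := [set i | 1 - w i \in m].
have [||L1S mS] := @central_idem_lift _ p_pr _ maxM pM _ C w S Lw.
- by move=> i; rewrite inE.
- move=> i; rewrite inE => S'i; have:= central_locmax_val i mw.
  rewrite (_ : _ - _ = - (w i * (1 - w i))); last by ring.
  rewrite rpredN => /locmax_prime; rewrite (negPf S'i) orbF; apply.
    exact: central_loc_val.
  by rewrite rpredB ?rpred1 ?central_loc_val.
pose eS u := central_coef (fun i : Iirr C => (i \in S)%:R) u.
have meS u : u \in C -> eS u - e u \in m.
  by move=> Cu; rewrite -(cw u Cu) -central_coefB mS.
have mSf : \sum_(u in x ^: G :&: C) eS (u^-1 * z)%g \in m.
  rewrite -[X in X \in _](subrK (\sum_(u in x ^: G :&: C) f u)) rpredD //.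
  rewrite -sumrB rpred_sum // => u /setIP[_ Cu].
  by rewrite meS ?groupM ?groupV.
rewrite -[e g](subKr (eS g)) rpredB ?meS //.
(* The term at [x] is [eS g]. Every other [a] is a [p]-element not conjugate to [x] in [C], as [x]
   is central there, so the other terms sum to 0. *)
move: mSf; rewrite (big_setD1 x) /=; last by rewrite inE class_refl.
rewrite {1}/z mulKg (@central_stable_sum0 C) ?addr0 //.
  apply/subsetP=> c Cc; apply/normP; rewrite conjDg conjIg conjGid //.
  rewrite (normP (subsetP (class_norm x G) c (subsetP sCG c Cc))).
  by rewrite conjg_set1 (_ : x ^ c = x)%g //; apply/conjg_fixP/commgP/commute_sym/cC.
move=> a /setD1P[ne_ax /setIP[xG_a Ca]].
apply: (block_class_sum_eq0 p_pr pM L1S Ca Cz).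
have p_a : p.-elt a by case/imsetP: xG_a => v _ ->; rewrite p_eltJ.
have -> : z.`_p = x.
  rewrite consttM; last exact/commute_sym/cC.
  by rewrite (eqP p'g) mulg1 constt_p_elt.
rewrite constt_p_elt //; apply: contra ne_ax => /imsetP[v Cv ->].
by apply/eqP/conjg_fixP/commgP/commute_sym/cC.
Qed.

End Nonvanishing.

Theorem theorem24 (p : nat) (p_pr : prime p)
    (M : {pred algC}) (maxM : Aint_maximal_ideal M) (pM : p%:R \in M)
    (gT : finGroupType) (G : {group gT})
    (B : {set Iirr G}) (blockB : is_block M B)
    (D : {group gT}) (defD : defect_group p M B D)
    (x y : gT) (Dx : x \in D) (Dy : y \in D) :
  (forall i : Iirr G, i \in B -> 'chi_i x = 'chi_i y) <-> y \in x ^: G.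

Proof.
split=> [eqB | /imsetP[u Gu ->] i _]; last by rewrite cfunJ.
have LB := block_central_loc p_pr maxM pM blockB.
have [k [g [[nzB _] Kg sylD]]] := defD.
have Gg: g \in G.
  by case/imsetP: (enum_valP k) Kg => a Ga -> /(subsetP (class_subG Ga (subxx G))).
have sDC: D \subset 'C_G[g] := pHall_sub sylD.
have GD u : u \in D -> u \in G by move/(subsetP sDC)/setIP=> [].
have p_D u : u \in D -> p.-elt u by apply/mem_p_elt/(pHall_pgroup sylD).
(* The block idempotent has the indicator of [B] as its central character values. *)
have e_g: central_coef (fun i => (i \in B)%:R) g \notin locmax maxM.
  suffices <-: block_idem_coef B g = central_coef (fun i => (i \in B)%:R) g.
    exact/nonzero_residue_locmax/nzB.
  rewrite /block_idem_coef /central_coef big_mkcond; congr (_ * _).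
  by apply: eq_bigr => i _; case: ifP => _; rewrite ?mul1r ?mul0r.
have Cg: g \in 'C_G[x].
  by have /setIP[_ /cent1P cxg] := subsetP sDC x Dx; rewrite inE Gg; apply/cent1P.
have [i Bi nz_chi] := block_nonvanishing p_pr pM LB (GD x Dx) Cg (p_D x Dx) e_g.
apply: contraT => not_xy; case/negP: nz_chi.
have := block_class_sum_eq0 p_pr pM LB (GD x Dx) (GD y Dy).
rewrite !constt_p_elt ?p_D // class_sym => /(_ not_xy).
(* Since ['chi_j y^-1] is the conjugate of ['chi_j x] on [B], the vanishing sum has nonnegative
   terms, so each of them is 0. *)
rewrite block_class_sumE ?GD // (eq_bigr (fun j => `|'chi_j x| ^+ 2)) => [|j Bj].
  move/eqP; rewrite psumr_eq0 => [/allP/(_ i) | j _]; last exact: exprn_ge0.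
  by rewrite mem_index_enum Bi expf_eq0 normr_eq0; apply.
by rewrite irr_inv -eqB // normCK.
Qed.
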